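(* Let $X$ be a Banach space. If $T\in\mathrm{Lip}_0(X,X)$ attains its Lipschitz numerical radius at $(x,y,x^* )\in\Pi$ and $T$ is Gâteaux differentiable at every point of the segment $[x,y]$, then for every $u\in[x,y]$ the Gâteaux derivative $D_T(u)\in\mathcal{L}(X,X)$ attains its numerical radius at $\left(\frac{x-y}{\|x-y\|},\frac{x^*}{\|x^*\|}\right)$.
   Context: $X$ is a real or complex Banach space with dual $X^*$; $\mathcal{L}(X,X)$ is the space of bounded linear operators on $X$; $S_X$ is the unit sphere. $\mathrm{Lip}_0(X,X)$ is the space of Lipschitz maps $T:X\to X$ with $T(0)=0$. For $x\in X$, $D(x)=\{x^*\in X^*: x^*(x)=\|x^*\|\|x\|=\|x\|^2\}$, and $\Pi=\{(x,y,x^* )\in X\times X\times X^* : x\neq y,\ x^*\in D(x-y)\}$. The Lipschitz numerical radius is $\nu_L(T)=\sup\left\{\frac{|x^*(Tx-Ty)|}{\|x-y\|^2}: (x,y,x^* )\in\Pi\right\}$; $T$ attains it at $(x,y,x^* )\in\Pi$ if the supremum equals the value at that triple. For $R\in\mathcal{L}(X,X)$ the numerical radius is $\nu(R)=\sup\{|x^*(Rx)|: (x,x^* )\in S_X\times S_{X^*},\ x^*(x)=1\}$; $R$ attains it at $(x,x^* )$ if $x\in S_X$, $x^*\in S_{X^*}$, $x^*(x)=1$ and $|x^*(Rx)|=\nu(R)$. The Gâteaux derivative of $T$ at $u$ is the bounded linear operator $D_T(u)(z)=\lim_{t\to0}\frac{T(u+tz)-T(u)}{t}$, $z\in X$. $[x,y]=\{\lambda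 x+(1-\lambda)y:0\le\lambda\le1\}$. *)

(* Defs.v *)
From HB Require Import structures.
From mathcomp Require Import all_boot all_order all_algebra.
From mathcomp Require Import all_classical all_reals all_analysis.
From mathcomp Require Import complex.

Set Implicit Arguments.
Unset Strict Implicit.
Unset Printing Implicit Defensive.

Import Order.TTheory GRing.Theory Num.Theory.
Import numFieldNormedType.Exports.

Local Open Scope classical_set_scope.
Local Open Scope ring_scope.

Variant scalar_kind := RealScalars | ComplexScalars.

Definition scalar_field (R : realType) (k : scalar_kind) : numFieldType :=
  match k with
  | RealScalars => R
  | ComplexScalars => R[i]
  end.

(* Norms in a normed module over [scalar_field R k] are elements of [scalar_field R k];
   [to_real] reads them as elements of R, where suprema exist. *)
Definition to_real (R : realType) (k : scalar_kind) : scalar_field R k -> R :=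
  match k with
  | RealScalars => fun a => a
  | ComplexScalars => fun a => complex.Re a
  end.

Definition of_real (R : realType) (k : scalar_kind) : R -> scalar_field R k :=
  match k with
  | RealScalars => fun a => a
  | ComplexScalars => fun a => Complex a 0
  end.
Arguments of_real {R} k.

Section LipschitzNumericalRadius.
Context {R : realType} {k : scalar_kind}.
Local Notation K := (scalar_field R k).

(* For linear maps, boundedness near 0 is operator boundedness
   ([linear_boundedP]) and continuity ([linear_bounded_continuous]). *)
Definition bounded_operators (V W : normedModType K) : set {linear V -> W} :=
  [set f | bounded_near f (nbhs (0 : V))].

Context {X : normedModType K}.
Implicit Types (T : X -> X) (A : {linear X -> X}) (f : {linear X -> K^o}).

Definition dual_space : set {linear X -> K^o} := @bounded_operators X K^o.

Definition dual_norm f : K :=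
  of_real k (sup [set to_real `|f z| | z in [set z : X | `|z| <= 1]]).

Definition Lip0 : set (X -> X) := [set T | lipschitz T /\ T 0 = 0].

Definition duality_map (x : X) : set {linear X -> K^o} :=
  [set f | [/\ dual_space f, f x = dual_norm f * `|x| & f x = `|x| ^+ 2]].

Definition Pi_triples : set (X * X * {linear X -> K^o}) :=
  [set p | p.1.1 <> p.1.2 /\ duality_map (p.1.1 - p.1.2) p.2].

Definition lipschitz_quotient T (p : X * X * {linear X -> K^o}) : R :=
  to_real (`|p.2 (T p.1.1 - T p.1.2)| / `|p.1.1 - p.1.2| ^+ 2).

Definition lipschitz_numerical_radius T : \bar R :=
  ereal_sup [set (lipschitz_quotient T p)%:E | p in Pi_triples].

Definition attains_lipschitz_numerical_radius T
    (p : X * X * {linear X -> K^o}) : Prop :=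
  Pi_triples p /\ lipschitz_numerical_radius T = (lipschitz_quotient T p)%:E.

Definition state_pairs : set (X * {linear X -> K^o}) :=
  [set p | [/\ `|p.1| = 1, dual_space p.2, dual_norm p.2 = 1 & p.2 p.1 = 1]].

Definition numerical_radius A : \bar R :=
  ereal_sup [set (to_real `|p.2 (A p.1)|)%:E | p in state_pairs].

Definition attains_numerical_radius A (p : X * {linear X -> K^o}) : Prop :=
  state_pairs p /\ (to_real `|p.2 (A p.1)|)%:E = numerical_radius A.

(* [is_derive] takes the limit over all scalars t -> 0, complex ones included
   when k = ComplexScalars.  For Lipschitz T this agrees with real t -> 0. *)
Definition is_gateaux_derivative T (u : X) A : Prop :=
  bounded_operators A /\ forall z : X, is_derive u z T (A z).

Definition gateaux_differentiable T (u : X) : Prop :=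
  exists A, is_gateaux_derivative T u A.

Definition segment (x y : X) : set X :=
  [set of_real k l *: x + of_real k (1 - l) *: y
     | l in [set l : R | 0 <= l <= 1]].

End LipschitzNumericalRadius.

(* Main.v *)
(* Put d = x - y and let q be the Lipschitz numerical radius of T.  If f is in
   the duality map at z then so is t f at t z for t > 0, whence
   |f (T (u + t z) - T u)| <= q |z|^2 t; letting t -> 0 bounds the numerical
   radius of the derivative at u by q.  For f = xs, z = d this says that
   g s = xs (T (y + s d)) is Lipschitz with constant q |d|^2, while attainment
   gives |g 1 - g 0| = q |d|^2.  Hence |g b - g a| = q |d|^2 (b - a) on [0, 1],
   and in the limit |xs (D_T(u) d)| = q |d|^2 at every point u of the segment. *)

Require Import Defs.
From mathcomp Require Import all_boot all_order all_algebra.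
From mathcomp Require Import all_classical all_reals all_analysis.
From mathcomp Require Import complex ring.

Set Implicit Arguments.
Unset Strict Implicit.
Unset Printing Implicit Defensive.

Import Order.TTheory GRing.Theory Num.Theory.
Import numFieldNormedType.Exports.
Local Open Scope classical_set_scope.
Local Open Scope ring_scope.

Section RealPart.
Context {R : realType} {k : scalar_kind}.
Local Notation K := (scalar_field R k).

(** The order of [R[i]] compares only numbers with equal imaginary parts, so [0 <= a] already makes
    [a] real. *)
Lemma to_realK (a : K) : 0 <= a -> of_real k (to_real a) = a.
Proof.
by move: a; case: k => //= -[a b]; rewrite lecE /= => /andP[/eqP -> _].
Qed.

Lemma to_realM (a b : K) : 0 <= a -> to_real (a * b) = to_real a * to_real b.
Proof.
move: a b; case: k => //= -[a a'] [b b']; rewrite lecE /= => /andP[/eqP -> _].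
by rewrite mul0r subr0.
Qed.

Lemma of_realM (a b : R) : of_real k (a * b) = of_real k a * of_real k b.
Proof.
case: k => //=; apply/eqP.
by rewrite eq_complex /= !(mulr0, mul0r, subr0, addr0) !eqxx.
Qed.

Lemma of_realB1 (a : R) : of_real k (1 - a) = 1 - of_real k a.
Proof. by case: k => //=; apply/eqP; rewrite eq_complex /= subr0 !eqxx. Qed.

Lemma ler_of_real (a b : R) : (of_real k a <= of_real k b) = (a <= b).
Proof. by case: k => //=; rewrite lecE /= eqxx. Qed.

Lemma ler_to_real (a b : K) : a <= b -> to_real a <= to_real b.
Proof. by move: a b; case: k => //= a b; rewrite lecE => /andP[]. Qed.

Lemma of_real0 : of_real k (0 : R) = 0.
Proof. by case: k. Qed.

Lemma of_real1 : of_real k (1 : R) = 1.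
Proof. by case: k. Qed.

End RealPart.

Lemma sup_scale (R : realType) (E : set R) (c : R) :
  0 < c -> has_sup E -> sup [set c * a | a in E] = c * sup E.
Proof.
move=> c0 hE; have [[a0 Ea0] _] := hE; apply/eqP; rewrite eq_le; apply/andP; split.
  apply: ge_sup; first by exists (c * a0), a0.
  by move=> _ [a Ea <-]; rewrite ler_pM2l//; exact: sup_upper_bound.
rewrite -ler_pdivlMl//; apply: ge_sup; first by exists a0.
move=> a Ea; rewrite ler_pdivlMl//; apply: ub_le_sup; last by exists a.
by exists (c * sup E) => _ [b Eb <-]; rewrite ler_pM2l//; exact: sup_upper_bound.
Qed.

Section NumericalRadius.
Context {R : realType} {k : scalar_kind}.
Local Notation K := (scalar_field R k).
Context {X : normedModType K}.
Implicit Types (T : X -> X) (f g : {linear X -> K^o}).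

Lemma functionalZ f (c : K) (z : X) : f (c *: z) = c * f z.
Proof. exact: linearZ. Qed.

Lemma dual_space_bound f : dual_space f ->
  exists2 M : K, 0 < M & forall z, `|f z| <= M * `|z|.
Proof.
by move=> /linear_boundedP/pinfty_ex_gt0[M M0 fM]; exists M.
Qed.

Lemma dual_space_scale f g (c : K) : (forall z, g z = c * f z) ->
  dual_space f -> dual_space g.
Proof.
move=> gE /bounded_funP fb; apply/bounded_funP => r.
have [M fM] := fb r; exists (`|c| * M) => z zr.
by rewrite gE normrM ler_wpM2l// fM.
Qed.

Lemma dual_norm_scale f g (c : K) : (forall z, g z = c * f z) -> 0 < c ->
  dual_space f -> dual_norm g = c * dual_norm f.
Proof.
move=> gE c0 fd; rewrite -[in RHS](to_realK (ltW c0)) -of_realM; congr of_real.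
have rc0 : 0 < to_real c.
  by rewrite ltNge -(ler_of_real (k := k)) (to_realK (ltW c0)) of_real0 lt_geF.
rewrite -sup_scale//; last first.
  split; first by exists (to_real `|f 0|), 0 => //=; rewrite normr0 ler01.
  have [M M0 fM] := dual_space_bound fd; exists (to_real M) => _ [z /= z1 <-].
  apply: ler_to_real; apply: le_trans (fM z) _.
  by rewrite ler_piMr// ltW.
rewrite image_comp; congr sup; apply: eq_imagel => z _ /=.
by rewrite gE normrM (gtr0_norm c0) to_realM// ltW.
Qed.

(** A general complex scalar would have to be conjugated on the functional; a positive one is real,
    so the same [c] serves on both sides. *)
Lemma duality_map_scale f g (c : K) (z : X) : (forall z, g z = c * f z) ->
  0 < c -> duality_map z f -> duality_map (c *: z) g.
Proof.
move=> gE c0 [fd fn fz]; split.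
- exact: dual_space_scale gE fd.
- rewrite gE functionalZ fn (dual_norm_scale gE)// normrZ (gtr0_norm c0); ring.
- by rewrite gE functionalZ fz normrZ (gtr0_norm c0) exprMn; ring.
Qed.

(** A bounded functional passes through the limit: if [f] has bound [M], difference quotients of [T]
    within [e / M] of [w] have images within [e] of [f w]. *)
Lemma derive_approx T f (u z w : X) (e : K) :
  is_derive u z T w -> dual_space f -> 0 < e ->
  exists2 d : K, 0 < d & forall h : K, h != 0 -> `|h| < d ->
    `|f w - h^-1 * f (T (u + h *: z) - T u)| < e.
Proof.
move=> [Td <-] /dual_space_bound[M M0 fM] e0.
have : (fun h => h^-1 *: ((T \o shift u) (h *: z) - T u)) @ 0^' --> 'D_z T u.
  exact: Td.
move=> /cvgrPdist_lt/(_ (e / M)); rewrite divr_gt0// => /(_ isT).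
move=> /nbhs_ballP[d /= d0 dP]; exists d => // h h0 hd.
rewrite -functionalZ -linearB; apply: le_lt_trans (fM _) _.
rewrite mulrC -ltr_pdivlMr// (addrC u).
by apply: (dP h) => //; rewrite /ball /= sub0r normrN.
Qed.

Lemma le_norm_derive T f (u z w : X) (b : K) :
  is_derive u z T w -> dual_space f ->
  (forall h : K, 0 < h -> `|f (T (u + h *: z) - T u)| <= b * h) ->
  `|f w| <= b.
Proof.
move=> Tw fd Tb; apply/ler_addgt0Pr => e e0.
(* One positive increment below the radius [d] is enough, even though the limit runs over all
   scalars. *)
have [d d0 /(_ (d / 2))] := derive_approx Tw fd e0.
have h0 : 0 < d / 2 by rewrite divr_gt0.
rewrite gt_eqF// gtr0_norm// gtr_pMr// invf_lt1// ltr1n => /(_ isT isT).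
set q := _^-1 * _ => fq.
have qb : `|q| <= b.
  by rewrite normrM normfV (gtr0_norm h0) ler_pdivrMl// [_ * b]mulrC Tb.
rewrite -(subrK q (f w)) addrC (le_trans (ler_normD _ _))// lerD// ltW//.
Qed.

(* Increments along [(0, 1] s] suffice: this gives one-sided limits, as needed
   at the endpoints of a segment. *)
Lemma ge_norm_derive T f (u z w : X) (a s : K) :
  is_derive u z T w -> dual_space f -> s != 0 ->
  (forall t : K, 0 < t <= 1 ->
     a * (t * `|s|) <= `|f (T (u + (t * s) *: z) - T u)|) ->
  a <= `|f w|.
Proof.
move=> Tw fd s0 Ta; apply/ler_addgt0Pr => e e0.
have [d d0 dP] := derive_approx Tw fd e0.
have sd : 0 < `|s| + d by rewrite addr_gt0// normr_gt0.
(* This choice gives both [t <= 1] and [t * |s| < d]. *)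
pose t := d / (`|s| + d).
have t0 : 0 < t by rewrite divr_gt0.
have t1 : t <= 1 by rewrite ler_pdivrMr// mul1r lerDr.
have nts : `|t * s| = t * `|s| by rewrite normrM gtr0_norm.
have := dP (t * s); rewrite mulf_neq0// ?gt_eqF// nts => /(_ isT).
have -> : t * `|s| < d.
  by rewrite mulrAC ltr_pdivrMr// ltr_pM2l// ltrDl.
move=> /(_ isT); set q := _^-1 * _ => fq.
have aq : a <= `|q|.
  rewrite normrM normfV nts mulrC ler_pdivlMr ?Ta ?t0//.
  by rewrite mulr_gt0// normr_gt0.
apply: le_trans aq _; rewrite -[q](subrK (f w)) addrC.
by rewrite (le_trans (ler_normD _ _))// lerD2l distrC ltW.
Qed.

(* [t f] belongs to the duality map at [t z], so the quotient at
   [(u + t z, u, t f)] is at most the attained radius. *)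
Lemma duality_map_radius_bound T (x y z u : X) f xs (t : K) :
  attains_lipschitz_numerical_radius T (x, y, xs) ->
  duality_map z f -> z != 0 -> 0 < t ->
  `|f (T (u + t *: z) - T u)| <=
    `|xs (T x - T y)| / `|x - y| ^+ 2 * `|z| ^+ 2 * t.
Proof.
move=> [_ nuE] zf z0 t0.
set g := t \*: f : {linear X -> K^o}.
have gE v : g v = t * f v by [].
have Pi_g : Pi_triples (u + t *: z, u, g).
  split=> /=.
    move=> /eqP; rewrite -subr_eq0 addrAC subrr add0r scaler_eq0 (negbTE z0).
    by rewrite gt_eqF.
  by rewrite addrAC subrr add0r; exact: duality_map_scale zf.
have : ((lipschitz_quotient T (u + t *: z, u, g))%:E <=
        (lipschitz_quotient T (x, y, xs))%:E)%E.
  by rewrite -nuE; apply: ereal_sup_ubound; exists (u + t *: z, u, g).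
rewrite lee_fin -(ler_of_real (k := k)) /lipschitz_quotient !to_realK; last 2 first.
- by rewrite divr_ge0// exprn_ge0.
- by rewrite divr_ge0// exprn_ge0.
rewrite /= addrAC subrr add0r !normrZ (gtr0_norm t0).
(* The functional [g] contributes one factor [t] and the squared length of [t z] contributes two, so
   a single [t] remains on the right. *)
rewrite ler_pdivrMr ?exprn_gt0 ?mulr_gt0 ?normr_gt0// -[`|f _| <= _](ler_pM2l t0).
set q := _ / _; rewrite (_ : q * _ = t * (q * `|z| ^+ 2 * t))//; ring.
Qed.

End NumericalRadius.

Theorem proposition2p5 (R : realType) (k : scalar_kind)
    (X : completeNormedModType (scalar_field R k)) (T : X -> X)
    (x y : X) (xs : {linear X -> (scalar_field R k)^o}) :
  Lip0 T ->
  attains_lipschitz_numerical_radius T (x, y, xs) ->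
  (forall u : X, segment x y u -> gateaux_differentiable T u) ->
  forall u : X, segment x y u ->
  forall DTu : {linear X -> X}, is_gateaux_derivative T u DTu ->
  attains_numerical_radius DTu
    (`|x - y|^-1 *: (x - y), (dual_norm xs)^-1 \*: xs : {linear X -> (scalar_field R k)^o}).
Proof.
move=> _ nuT _ u [l /= /andP[l0 l1] <-{u}] A [_ TA].
set K := scalar_field R k.
have [[/= /eqP xy Dxs] _] := nuT; have [xsd xsn xsx] := Dxs.
pose d := x - y; pose N := `|d|.
have d0 : d != 0 by rewrite subr_eq0.
have N0 : 0 < N by rewrite normr_gt0.
have xsN : dual_norm xs = N.
  by apply: (mulIf (lt0r_neq0 N0)); rewrite -xsn xsx expr2.
pose q := `|xs (T x - T y)| / N ^+ 2.
(* Reparametrise the segment from [y], so that [lam = 0] is [y] and [lam = 1] is [x]. *)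
have [lam [lamE lam0 lam1]] : exists lam : K,
    [/\ of_real k l *: x + of_real k (1 - l) *: y = y + lam *: d, 0 <= lam & lam <= 1].
  exists (of_real k l); split.
  - by rewrite of_realB1 scalerBl scale1r /d scalerBr addrCA.
  - by rewrite -(of_real0 (k := k)) ler_of_real.
  - by rewrite -(of_real1 (k := k)) ler_of_real.
rewrite lamE in TA *.
have le_q z f : duality_map z f -> z != 0 -> `|f (A z)| <= q * `|z| ^+ 2.
  move=> zf z0; apply: le_norm_derive (TA z) _ _; first by case: zf.
  by move=> h h0; exact: duality_map_radius_bound nuT zf z0 h0.
pose g s := xs (T (y + s *: d)).
have g_le a b : a <= b -> `|g b - g a| <= q * N ^+ 2 * (b - a).
  (* The radius bound needs a positive increment, hence the separate case [a = b]. *)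
  rewrite -subr_ge0 le_eqVlt => /predU1P[ba0|ba].
    by rewrite -ba0 mulr0 (_ : b = a) ?subrr ?normr0//; apply/eqP; rewrite -subr_eq0 -ba0.
  rewrite -linearB /=.
  have := duality_map_radius_bound (y + a *: d) nuT Dxs d0 ba.
  by rewrite -addrA -scalerDl addrCA subrr addr0.
have g01 : `|g 1 - g 0| = q * N ^+ 2.
  rewrite /g scale1r scale0r addr0 (addrC y) /d subrK -linearB /q mulfVK//.
  by rewrite expf_neq0// lt0r_neq0.
(* The increments over [[0, a]] and [[b, 1]] are at most [q * N ^+ 2] times their lengths;
   subtracting them from the total over [[0, 1]] leaves this much for [[a, b]]. *)
have g_ge a b : 0 <= a -> a <= b -> b <= 1 -> q * N ^+ 2 * (b - a) <= `|g b - g a|.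
  move=> a0 ab b1.
  have : `|g 1 - g 0| <= `|g 1 - g b| + (`|g b - g a| + `|g a - g 0|).
    rewrite -[g 1 - g 0](subrKA (g b)) (le_trans (ler_normD _ _))// lerD2l.
    by rewrite -[g b - g 0](subrKA (g a)) ler_normD.
  rewrite g01 => /le_trans/(_ (lerD (g_le _ _ b1) (lerD (lexx _) (g_le _ _ a0)))).
  rewrite addrCA -lerBlDr; congr (_ <= _); ring.
have ge_q : q * N ^+ 2 <= `|xs (A d)|.
  (* Increments must stay on the segment: at the endpoint [x] they go back towards [y], elsewhere
     forward towards [x]. *)
  have [lam1E|lam1N] := eqVneq lam 1.
    apply: (ge_norm_derive (s := -1) (TA d) xsd); first by rewrite oppr_eq0 oner_eq0.
    move=> t /andP[t0 t1].
    rewrite normrN1 mulr1 mulrN1 -addrA -scalerDl linearB distrC lam1E.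
    apply: le_trans (g_ge (1 - t) 1 _ _ _) => //.
    - by rewrite opprB addrC subrK.
    - by rewrite subr_ge0.
    - by rewrite gerBl ltW.
  have s0 : 0 < 1 - lam by rewrite subr_gt0 lt_neqAle lam1N.
  apply: (ge_norm_derive (s := 1 - lam) (TA d) xsd); first exact: lt0r_neq0.
  move=> t /andP[t0 t1].
  rewrite (gtr0_norm s0) -addrA -scalerDl linearB.
  apply: le_trans (g_ge lam (lam + t * (1 - lam)) _ _ _) => //.
  - by rewrite (addrC lam) addrK.
  - by rewrite lerDl ltW// mulr_gt0.
  - by rewrite addrC -lerBrDr ler_piMl// ltW.
have xsAd : `|xs (A d)| = q * N ^+ 2.
  by apply/eqP; rewrite eq_le ge_q le_q.
set p := (_, _).
(* Normalising divides [d] and [xs] by [N] each, which cancels [N ^+ 2]. *)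
have pE : `|p.2 (A p.1)| = q.
  rewrite /p /= linearZ functionalZ /= -/d -/N xsN normrM normrM xsAd normfV normr_id.
  by rewrite -/N mulrA -invfM -expr2 mulrC mulfK// expf_neq0// lt0r_neq0.
have p_state : state_pairs p.
  have pxs z : p.2 z = N^-1 * xs z by rewrite /p /= xsN.
  have Ninv : 0 < N^-1 by rewrite invr_gt0.
  split.
  - by rewrite /p /= normrZ normfV normr_id mulVf ?lt0r_neq0.
  - exact: dual_space_scale pxs xsd.
  - by rewrite (dual_norm_scale pxs)// xsN mulVf ?lt0r_neq0.
  - rewrite pxs /p /= functionalZ xsx -/d -/N mulrA -invfM -expr2.
    by rewrite mulVf// expf_neq0// lt0r_neq0.
split=> //; apply/eqP; rewrite eq_le; apply/andP; split.
  by apply: ereal_sup_ubound; exists p.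
(* For a state pair all norms are 1, so [f] lies in the duality map at [z] and [le_q] applies. *)
apply: ge_ereal_sup => _ [[z f] /= [z1 fd fn fz] <-].
rewrite lee_fin; apply: ler_to_real; rewrite pE.
have := le_q z f; rewrite z1 expr1n mulr1; apply.
  by split; rewrite // fz ?fn z1 ?mulr1 ?expr1n.
by rewrite -normr_eq0 z1 oner_eq0.
Qed.
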